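(* Assume all facility–client distances and facility opening costs are bounded by a polynomial in $m=|F|$. Starting from an empty set of clients, the dynamic algorithm described in the context incurs total recourse at most $O(t\log m)$ to handle any sequence of $t$ updates (client insertions and deletions); that is, its amortized recourse is $O(\log m)$.
   Context: Facility location: finite facility set $F$, $m=|F|$, finite client set $D$, in a common metric space; $d_{ij}>0$ is the distance between facility $i$ and client $j$ (triangle inequality holds), $f_i\ge0$ the opening cost of facility $i$. Clusters: a cluster is a pair $C=(i,A)$ with $i\in F$, $A\subseteq D$, designated critical or satellite; satellite clusters have exactly one client. $cost(C)=\sum_{j\in A}d_{ij}$ if satellite, $f_i+\sum_{j\in A}d_{ij}$ if critical; $cost_{avg}(C)=cost(C)/|A|$. A clustering is a collection $\mathcal{C}$ of clusters in which every client lies in exactly one cluster and, for each facility $i$ with $\mathcal{C}(i)$ (clusters of $\mathcal{C}$ with facility $i$) nonempty, exactly one cluster of $\mathcal{C}(i)$ is critical; facility $i$ is open iff $\mathcal{C}(i)\ne\emptyset$ and each client is assigned to the facility of its cluster. Each $C\in\mathcal{C}$ has a level $\ell(C)\in\mathbb{Z}$; $\ell(j)=\ell(C)$ for clients $j$ of $C$. $\kappa^*_{ij}$ is the unique integer with $2^{\kappa^*_{ij}-4}\le d_{ij}<2^{\kappa^*_{ij}-3}$. A cluster $C=(i,A)$ (not necessarily in $\mathcal{C}$) is blocking at level $k$ w.r.t. $\mathcal{C}$ if (a) $cost_{avg}(C)<2^{k-3}$; (b) $\ell(j)>k\ge\kappa^*_{ij}$ for all $j\in A$; (c) if $C$ is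 satellite, some critical $C^*\in\mathcal{C}(i)$ has $\ell(C^* )\le k$; if $C$ is critical, $k\le\ell(C')$ for all $C'\in\mathcal{C}(i)$. Invariant (I1): $cost_{avg}(C)<2^{\ell(C)}$ for all $C\in\mathcal{C}$. Invariant (I4): no cluster is blocking at any level w.r.t. $\mathcal{C}$. The algorithm: initially $D=\emptyset$, $\mathcal{C}=\emptyset$. Deletion of $j$: remove $j$ from the client set of its cluster, then call Fix-Clustering. Insertion of $j$: if no facility is open, pick $i$ minimizing $d_{ij}+f_i$ and create the critical cluster $(i,\{j\})$ at the level $k$ with $d_{ij}+f_i\in[2^{k-4},2^{k-3})$; otherwise pick any open facility $i$, let $C=(i,A)$ be its critical cluster, and if $\kappa^*_{ij}\le\ell(C)$ set $A\leftarrow A\cup\{j\}$, else add the satellite cluster $(i,\{j\})$ at level $\kappa^*_{ij}$; then call Fix-Clustering. Fix-Clustering: while (I4) or (I1) is violated: if (I4) is violated, find a cluster $C$ blocking at some level $k$ and call Fix-Blocking$(C,k)$; otherwise find a cluster $C$ violating (I1) and call Fix-Level$(C)$. Fix-Blocking$(C=(i,A),k)$: add $C$ to $\mathcal{C}$ with $\ell(C)=k$ and remove every $j\in A$ from its previous cluster; if $C$ is critical and $C'=(i,A')$ was the critical cluster of $i$ just before this call, then for each $j\in A'$ add a satellite cluster $(i,\{j\})$ at level $\ell(C')$, and remove $C'$. Fix-Level$(C=(i,A))$ with $k=\ell(C)$: if $\mathcal{C}(i)=\{C\}$ and $A=\emptyset$, remove $C$ and stop; if $C$ is critical, absorb into $A$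 every satellite cluster $(i,\{j\})$ at level $k$ (adding $j$ to $A$ and removing $(i,\{j\})$); finally, if still $cost_{avg}(C)\ge2^k$, set $\ell(C)\leftarrow k+1$. Recourse: one unit each time a facility is opened or closed, and one unit each time a client is reassigned from one facility to another.
   Formalization: The distances are also assumed bounded below by the inverse of a polynomial in m (1/d_ij ≤ P(m)) and m ≥ 2; without these the bound fails (exponentially small distances allow Ω(m) reassignments per insertion, and log 1 = 0). *)

(* Defs.v *)
From HB Require Import structures.
From mathcomp Require Import all_boot all_order all_algebra finmap.
From mathcomp Require Import all_classical all_reals all_analysis.

Set Implicit Arguments.
Unset Strict Implicit.
Unset Printing Implicit Defensive.

Import Order.TTheory GRing.Theory Num.Theory.

Local Open Scope fset_scope.
Local Open Scope ring_scope.

(* The integer k with 2^(k-4) <= x < 2^(k-3), which is unique for x > 0;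
   the default value 0 is used only for x <= 0. *)
Definition scale (R : realType) (x : R) : int :=
  xget 0 [set k : int | 2 ^ (k - 4) <= x < 2 ^ (k - 3)]%classic.

Section Algorithm.

Context {R : realType} {F : finType} {J : choiceType}.

(* ((i, A), c) is the cluster with facility i and client set A,
   critical if c = true and satellite if c = false. *)
Definition flcluster : choiceType := (F * {fset J} * bool)%type.

Definition fac (C : flcluster) : F := C.1.1.
Definition cli (C : flcluster) : {fset J} := C.1.2.
Definition critical (C : flcluster) : bool := C.2.

Definition crit_cluster (i : F) (A : {fset J}) : flcluster := (i, A, true).
Definition sat_cluster (i : F) (j : J) : flcluster := (i, [fset j], false).

Definition wf_cluster (C : flcluster) : bool :=
  critical C || (#|` cli C| == 1)%N.

Definition lcluster : choiceType := (flcluster * int)%type.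
Definition level (X : lcluster) : int := X.2.

Definition clustering : choiceType := {fset lcluster}.

(* The current client set D is the set of clients occurring in a cluster. *)
Definition clients (S : clustering) : {fset J} :=
  \bigcup_(X <- S) cli X.1.

Definition clusters_at (S : clustering) (i : F) : clustering :=
  [fset X in S | fac X.1 == i].

Definition is_open (S : clustering) (i : F) : bool :=
  clusters_at S i != fset0.

Definition assigned (S : clustering) (j : J) (i : F) : bool :=
  j \in clients (clusters_at S i).

(* Number of facilities opened or closed, plus number of clients reassigned to
   a different facility, when S is replaced by S'. Inserted and deleted clients
   are not counted, as they are assigned in only one of S and S'. *)
Definition recourse (S S' : clustering) : nat :=
  (#|[set i | is_open S i != is_open S' i]|
   + #|` [fset j in clients S | [exists i, exists i',
           [&& i != i', assigned S j i & assigned S' j i']]]|)%N.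

Variables (d : F -> J -> R) (f : F -> R).

Definition kappa (i : F) (j : J) : int := scale (d i j).

Definition cost (C : flcluster) : R :=
  (if critical C then f (fac C) else 0) + \sum_(j <- cli C) d (fac C) j.

(* A cluster without clients has infinite average cost, even if its opening
   cost is 0: it always violates (I1), and it is never blocking. *)
Definition cost_avg (C : flcluster) : \bar R :=
  if cli C == fset0 then +oo%E else (cost C / (#|` cli C|)%:R)%:E.

Definition blocking (S : clustering) (C : flcluster) (k : int) : Prop :=
  [/\ wf_cluster C /\ cli C `<=` clients S,
      (cost_avg C < (2 ^ (k - 3))%:E)%E,
      (forall j, j \in cli C ->
         (forall X, X \in S -> j \in cli X.1 -> k < level X) /\
         kappa (fac C) j <= k)
    & if critical C
      then forall X, X \in clusters_at S (fac C) -> k <= level X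
      else exists2 X, X \in clusters_at S (fac C)
                    & critical X.1 /\ level X <= k].

Definition level_ok (X : lcluster) : bool :=
  (cost_avg X.1 < (2 ^ level X)%:E)%E.

Definition I1 (S : clustering) : Prop := forall X, X \in S -> level_ok X.
Definition I4 (S : clustering) : Prop := forall C k, ~ blocking S C k.

(* A satellite cluster losing its only client ceases to exist, whereas a
   critical cluster losing all its clients stays (and keeps its facility open)
   until Fix-Level removes it. *)
Definition remove_clients (S : clustering) (A : {fset J}) : clustering :=
  let strip (X : lcluster) : lcluster :=
    ((fac X.1, cli X.1 `\` A, critical X.1), level X) in
  [fset X in [fset strip Y | Y in S] | wf_cluster X.1].

(* The previous critical cluster of the facility, if any, is turned into
   satellite clusters after it has lost the clients of C. *)
Definition fix_blocking (S : clustering) (C : flcluster) (k : int) : clustering :=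
  let S1 := remove_clients S (cli C) in
  if critical C then
    let old := [fset X in clusters_at S1 (fac C) | critical X.1] in
    let demoted : clustering :=
      [fset (sat_cluster (fac C) j, level X) | X in old, j in cli X.1] in
    (C, k) |` ((S1 `\` old) `|` demoted)
  else (C, k) |` S1.

Definition fix_level (S : clustering) (X : lcluster) : clustering :=
  let C := X.1 in
  let k := level X in
  if (clusters_at S (fac C) == [fset X]) && (cli C == fset0) then S `\ X
  else
    let absorbed : clustering :=
      if critical C then
        [fset Y in clusters_at S (fac C) | ~~ critical Y.1 & level Y == k]
      else fset0 in
    let C' : flcluster := (fac C, cli C `|` clients absorbed, critical C) in
    let k' := if ((2 ^ k)%:E <= cost_avg C')%E then k + 1 else k in
    (C', k') |` ((S `\ X) `\` absorbed).

(* One iteration of the loop of Fix-Clustering. *)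
Inductive fix_step (S : clustering) : clustering -> Prop :=
| Fix_Blocking C k : blocking S C k -> fix_step S (fix_blocking S C k)
| Fix_Level X : I4 S -> X \in S -> ~~ level_ok X ->
    fix_step S (fix_level S X).

Inductive update : Type := Insert of J | Delete of J.

(* The part of the handling of an update that precedes Fix-Clustering. *)
Inductive update_step (S : clustering) : update -> clustering -> Prop :=
| Insert_first i j :
    j \notin clients S ->
    (forall i', ~~ is_open S i') ->
    (forall i', d i j + f i <= d i' j + f i') ->
    update_step S (Insert j)
      ((crit_cluster i [fset j], scale (d i j + f i)) |` S)
| Insert_critical i j X :
    j \notin clients S ->
    X \in clusters_at S i -> critical X.1 ->
    kappa i j <= level X ->
    update_step S (Insert j)
      ((crit_cluster i (j |` cli X.1), level X) |` (S `\ X))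
| Insert_satellite i j X :
    j \notin clients S ->
    X \in clusters_at S i -> critical X.1 ->
    level X < kappa i j ->
    update_step S (Insert j) ((sat_cluster i j, kappa i j) |` S)
| Delete_client j :
    j \in clients S ->
    update_step S (Delete j) (remove_clients S [fset j]).

(* run us r S: some execution of the algorithm that starts without clients and
   receives the updates us reaches S, possibly in the middle of the call to
   Fix-Clustering for the last update, and has incurred recourse r so far.
   An update is received only when Fix-Clustering has stopped. *)
Inductive run : seq update -> nat -> clustering -> Prop :=
| run_init : run [::] 0%N fset0
| run_update us u r S S' :
    run us r S -> I1 S -> I4 S -> update_step S u S' ->
    run (rcons us u) (r + recourse S S')%N S'
| run_fix us r S S' :
    run us r S -> fix_step S S' -> run us (r + recourse S S')%N S'.

End Algorithm.

(* Main.v *)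
Require Import Defs.
From HB Require Import structures.
From mathcomp Require Import all_boot all_order all_algebra finmap.
From mathcomp Require Import all_classical all_reals all_analysis.
From mathcomp Require Import zify ring lra.

Set Implicit Arguments.
Unset Strict Implicit.
Unset Printing Implicit Defensive.

Import Order.TTheory GRing.Theory Num.Theory.

Local Open Scope ring_scope.

(** The recourse is paid by a potential: every client carries 5 units per level
    of its cluster above the lowest possible level.  Fix-Blocking lowers the
    level of each client it moves, so each such client releases 5 units, of
    which 3 pay for its reassignment and for opening and later closing a
    facility, and 2 are left to the critical cluster from which the client
    departs.  A critical cluster [(i, A)] formed at level [k] satisfies
    [|A| > f_i / 2 ^ (k - 3)]; since all its distances are below [2 ^ (k - 3)],
    it can violate (I1) at level [k] only once [7 |A| <= f_i / 2 ^ (k - 3)].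
    By then the departed clients have left enough to lift the remaining ones by
    one level.  Satellite clusters never violate (I1), and the critical cluster
    of a facility is always on its lowest level, so all levels stay in a window
    of width [O(log m)], which bounds the potential brought by an insertion. *)

(** * Sums over lists, powers of two and the function [scale] *)

Lemma ler_sum_cover (R : realType) (I : eqType) (s t : seq I) (g : I -> R) :
  uniq s -> {subset s <= t} -> {in t, forall x, 0 <= g x} ->
  \sum_(x <- s) g x <= \sum_(x <- t) g x.
Proof.
elim: t s => [|y t IHt] s uniq_s sub_st g_ge0.
  by case: s uniq_s sub_st => [|x s] // _ /(_ x (mem_head x s)).
have g_ge0t : {in t, forall x, 0 <= g x}.
  by move=> x xt; apply: g_ge0; rewrite inE xt orbT.
rewrite big_cons; have [ys|yNs] := boolP (y \in s).
  rewrite (perm_big _ (perm_to_rem ys)) big_cons lerD2l.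
  apply: IHt => //; first exact: rem_uniq.
  move=> x; rewrite mem_rem_uniq // inE => /andP[/negbTE xNy /sub_st].
  by rewrite inE xNy.
rewrite -[leLHS]add0r lerD ?g_ge0 ?mem_head //; apply: IHt => // x xs.
have := sub_st _ xs; rewrite inE => /orP[/eqP xy|//].
by rewrite -xy xs in yNs.
Qed.

Lemma expr2z_le (R : realType) (m n : int) :
  ((2 : R) ^ m <= 2 ^ n) = (m <= n).
Proof. by rewrite ler_eXz2l // ltr1n. Qed.

Lemma expr2z_lt (R : realType) (m n : int) :
  ((2 : R) ^ m < 2 ^ n) = (m < n).
Proof. by rewrite ltr_eXz2l // ltr1n. Qed.

Lemma expr2z_gt0 (R : realType) (m : int) : 0 < (2 : R) ^ m.
Proof. exact: exprz_gt0. Qed.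

Lemma expr2zD (R : realType) (m n : int) : (2 : R) ^ (m + n) = 2 ^ m * 2 ^ n.
Proof. by rewrite expfzDr // pnatr_eq0. Qed.

Lemma ltr_expr2 (R : realType) (x : R) : exists n : nat, x < 2 ^+ n.
Proof.
exists (Num.bound x); have [x0|x0] := leP 0 x.
  apply: lt_le_trans (archi_boundP x0) _.
  by rewrite -natrX ler_nat ltnW // ltn_expl.
by apply: lt_le_trans x0 _; rewrite exprn_ge0.
Qed.

Lemma scaleP (R : realType) (x : R) :
  0 < x -> 2 ^ (scale x - 4) <= x < 2 ^ (scale x - 3).
Proof.
move=> x0; have [k xk] : exists k : int, 2 ^ (k - 4) <= x < 2 ^ (k - 3).
  have [p xp] := ltr_expr2 x^-1.
  have xpV : 2 ^ (- p%:Z) < x.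
    by rewrite -invr_expz -exprnP invf_plt ?posrE ?exprn_gt0.
  (* Since [2 ^ (- p)] lies below [x], the exponent of the upper bound exceeds [-p]; after a shift
     by [p] it is the least natural number with the required property. *)
  have : exists n : nat, x < 2 ^ (n%:Z - p%:Z).
    have [q xq] := ltr_expr2 x; exists (q + p)%N.
    by rewrite PoszD addrK -exprnP.
  case/ex_minnP => n xn nmin; exists (n%:Z - p%:Z + 3).
  have -> : n%:Z - p%:Z + 3 - 3 = n%:Z - p%:Z by lia.
  rewrite xn andbT; case: n xn nmin => [|n] xn nmin.
    by move: (lt_trans xpV xn); rewrite expr2z_lt; lia.
  rewrite leNgt; apply/negP => xn'; have : (n.+1 <= n)%N; last by rewrite ltnn.
  apply: nmin; apply: lt_le_trans xn' _; rewrite expr2z_le; lia.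
by rewrite /scale; case: xgetP => [y _ //|/(_ k)].
Qed.

(** * Amortized analysis over a window of levels *)

Section Amortization.

Local Open Scope fset_scope.
Local Open Scope ring_scope.

Context {R : realType} {F : finType} {J : choiceType}.
Variables (d : F -> J -> R) (f : F -> R) (lmin lmax : int).
(** The shifts by 4 and 3 are those of [scale]: they turn bounds on distances and costs into the
    bounds [lmin] and [lmax] on [kappa], and into the bound [lmax] on the level at which a first
    facility opens. *)
Hypothesis d_ge : forall i j, 2 ^ (lmin - 4) <= d i j.
Hypothesis f_ge0 : forall i, 0 <= f i.
Hypothesis df_lt : forall i j, d i j + f i < 2 ^ (lmax - 3).

Implicit Types (S : @clustering F J) (X Y Z : @lcluster F J) (i : F) (j : J)
  (A : {fset J}).

Local Notation kappa := (kappa d).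

Lemma d_gt0 i j : 0 < d i j.
Proof. exact: lt_le_trans (expr2z_gt0 _ _) (d_ge i j). Qed.

Lemma d_lt_kappa i j : d i j < 2 ^ (kappa i j - 3).
Proof. by have /andP[] := scaleP (d_gt0 i j). Qed.

Lemma kappa_min i j : lmin <= kappa i j.
Proof.
have := le_lt_trans (d_ge i j) (d_lt_kappa i j); rewrite expr2z_lt; lia.
Qed.

Lemma kappa_max i j : kappa i j <= lmax.
Proof.
have /andP[h _] := scaleP (d_gt0 i j).
have : 2 ^ (kappa i j - 4) < (2 : R) ^ (lmax - 3).
  apply: le_lt_trans h _; apply: le_lt_trans (df_lt i j).
  by rewrite lerDl.
by rewrite expr2z_lt; lia.
Qed.

Lemma d_lt_level i j (k : int) : kappa i j <= k -> d i j < 2 ^ (k - 3).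
Proof.
move=> h; apply: lt_le_trans (d_lt_kappa i j) _; rewrite expr2z_le; lia.
Qed.

(** * Invariants of the clustering *)

(** These properties pass to every subset of a clustering. The existence of critical clusters is
    kept apart in [invariant], because it can fail halfway through a step, when the old critical
    cluster of a facility is gone and the new one is not yet added. *)
Record separated S : Prop := Separated {
  inv_wf : forall X, X \in S -> wf_cluster X.1;
  inv_disjoint : forall X Y j, X \in S -> Y \in S ->
    j \in cli X.1 -> j \in cli Y.1 -> X = Y;
  inv_critical_uniq : forall X Y, X \in S -> Y \in S ->
    critical X.1 -> critical Y.1 -> fac X.1 = fac Y.1 -> X = Y;
  inv_critical_level : forall X Y, X \in S -> Y \in S ->
    critical X.1 -> fac X.1 = fac Y.1 -> level X <= level Y;
  inv_kappa : forall X j, X \in S -> j \in cli X.1 ->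
    kappa (fac X.1) j <= level X;
  inv_max : forall X, X \in S -> level X <= lmax }.

Record invariant S : Prop := Invariant {
  inv_separated :> separated S;
  inv_critical_ex : forall X, X \in S ->
    exists Y, [/\ Y \in S, critical Y.1 & fac Y.1 = fac X.1] }.

Lemma separated_sub S S' : S' `<=` S -> separated S -> separated S'.
Proof.
move=> /fsubsetP sub [wfS disj uniq lev kap mx].
by split; [move=> X /sub | move=> X Y j /sub ? /sub | move=> X Y /sub ? /sub
  | move=> X Y /sub ? /sub | move=> X j /sub | move=> X /sub]; eauto.
Qed.

Lemma clientsP S j :
  reflect (exists2 X, X \in S & j \in cli X.1) (j \in clients S).
Proof.
apply: (iffP (bigfcupP _ _ _ _)) => [[X /andP[XS _] jX]|[X XS jX]];
  by exists X => //; rewrite XS.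
Qed.

Lemma in_clusters_at S i X :
  (X \in clusters_at S i) = (X \in S) && (fac X.1 == i).
Proof. by rewrite !inE. Qed.

Lemma is_openP S i :
  reflect (exists2 X, X \in S & fac X.1 = i) (is_open S i).
Proof.
apply: (iffP (fset0Pn _)) => [[X]|[X XS Xi]].
  by rewrite in_clusters_at => /andP[XS /eqP Xi]; exists X.
by exists X; rewrite in_clusters_at XS Xi eqxx.
Qed.

Lemma assignedP S j i :
  reflect (exists X, [/\ X \in S, fac X.1 = i & j \in cli X.1])
          (assigned S j i).
Proof.
apply: (iffP (clientsP _ _)) => [[X]|[X [XS Xi jX]]].
  by rewrite in_clusters_at => /andP[XS /eqP Xi] jX; exists X.
by exists X => //; rewrite in_clusters_at XS Xi eqxx.
Qed.

Lemma wf_satellite X : wf_cluster X.1 -> ~~ critical X.1 ->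
  exists j, cli X.1 = [fset j].
Proof. by rewrite /wf_cluster => /orP[->//|/cardfs1P]. Qed.

Lemma cost_avg_cli0 C : cli C = fset0 -> cost_avg d f C = +oo%E.
Proof. by rewrite /cost_avg => ->; rewrite eqxx. Qed.

Lemma cost_avgE C : cli C != fset0 ->
  cost_avg d f C = (cost d f C / #|` cli C|%:R)%:E.
Proof. by rewrite /cost_avg => /negbTE ->. Qed.

Lemma cost_avg_lt C (x : R) : (cost_avg d f C < x%:E)%E ->
  cli C != fset0 /\ cost d f C < x * #|` cli C|%:R.
Proof.
have [C0|C0] := boolP (cli C == fset0).
  by rewrite cost_avg_cli0 ?(eqP C0) // => /lt_geF; rewrite leey.
rewrite cost_avgE // lte_fin => h; split=> //.
by rewrite -ltr_pdivrMr // ltr0n cardfs_gt0.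
Qed.

Lemma cost_avg_ge C (x : R) : cli C != fset0 -> (x%:E <= cost_avg d f C)%E ->
  x * #|` cli C|%:R <= cost d f C.
Proof.
move=> C0; rewrite cost_avgE // lee_fin => h.
by rewrite -ler_pdivlMr // ltr0n cardfs_gt0.
Qed.

Lemma sumr_const_fset A (x : R) : \sum_(j <- A) x = x * #|` A|%:R.
Proof. by rewrite big_const_seq count_predT iter_addr addr0 mulr_natr. Qed.

Lemma sum_dist_le i A (x : R) : (forall j, j \in A -> d i j <= x) ->
  \sum_(j <- A) d i j <= x * #|` A|%:R.
Proof.
move=> dA; rewrite -sumr_const_fset.
by rewrite big_seq [leRHS]big_seq; apply: ler_sum => j; apply: dA.
Qed.

(** The average cost of a satellite is its single distance, which [inv_kappa] puts below
    [2 ^ (level X - 3)]. Hence Fix-Level is only ever called on critical clusters. *)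
Lemma satellite_level_ok S X : invariant S -> X \in S -> ~~ critical X.1 ->
  level_ok d f X.
Proof.
move=> inv XS Xsat; have [j Xj] := wf_satellite (inv_wf inv XS) Xsat.
have /(inv_kappa inv XS) jX : j \in cli X.1 by rewrite Xj inE.
rewrite /level_ok cost_avgE; last by rewrite Xj -cardfs_gt0 cardfs1.
rewrite lte_fin /cost (negbTE Xsat) Xj cardfs1 big_seq_fset1 add0r divr1.
by apply: lt_le_trans (d_lt_level jX) _; rewrite expr2z_le; lia.
Qed.

(** With at least one client, charging the opening cost to every client only increases the cost, so
    the average is at most the largest [d i j + f i]. This keeps the raises of Fix-Level below
    [lmax]. *)
Lemma level_lt_max C (k : int) : cli C != fset0 ->
  ((2 ^ k)%:E <= cost_avg d f C)%E -> k < lmax.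
Proof.
move=> C0 /(cost_avg_ge C0) h.
have C1 : (1 : R) <= #|` cli C|%:R by rewrite ler1n cardfs_gt0.
suff : (2 : R) ^ k <= 2 ^ (lmax - 3) by rewrite expr2z_le; lia.
rewrite -(ler_pM2r (lt_le_trans ltr01 C1)).
apply: le_trans h _; apply: (@le_trans _ _ (\sum_(j <- cli C) (d (fac C) j + f (fac C)))).
  rewrite /cost big_split /= addrC lerD2r sumr_const_fset.
  case: (critical C).
    by rewrite ler_peMr.
  by rewrite mulr_ge0 // ler0n.
rewrite -sumr_const_fset.
by apply: ler_sum => j _; apply/ltW/df_lt.
Qed.

(** The local function of [remove_clients], given a name for use in statements. *)
Definition strip A X : @lcluster F J :=
  ((fac X.1, cli X.1 `\` A, critical X.1), level X).

Lemma remove_clientsP S A X :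
  reflect (exists2 Y, Y \in S & X = strip A Y /\ wf_cluster X.1)
          (X \in remove_clients S A).
Proof.
rewrite /remove_clients !inE /=; apply: (iffP andP) => [[/imfsetP[Y YS ->] wfX]|].
  by exists Y.
by move=> [Y YS [-> wfX]]; split=> //; apply/imfsetP; exists Y.
Qed.

Lemma remove_clients_critical S A X : X \in S -> critical X.1 ->
  strip A X \in remove_clients S A.
Proof.
move=> XS Xcrit; apply/remove_clientsP; exists X => //; split=> //.
by rewrite /wf_cluster /critical /= -/(critical X.1) Xcrit.
Qed.

(** Critical clusters survive even when emptied, since [wf_cluster] restricts only satellites; so
    every open facility keeps its critical cluster. *)
Lemma invariant_remove S A : invariant S -> invariant (remove_clients S A).
Proof.
move=> inv; split; last first.
  move=> X /remove_clientsP[X' X'S [-> _]].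
  have [Y [YS Ycrit YX]] := inv_critical_ex inv X'S.
  by exists (strip A Y); split=> //; exact: remove_clients_critical.
split.
- by move=> X /remove_clientsP[Y _ []].
- move=> X Y j /remove_clientsP[X' X'S [-> _]] /remove_clientsP[Y' Y'S [-> _]].
  rewrite /strip /= !in_fsetD => /andP[_ jX] /andP[_ jY].
  by rewrite (inv_disjoint inv X'S Y'S jX jY).
- move=> X Y /remove_clientsP[X' X'S [-> _]] /remove_clientsP[Y' Y'S [-> _]].
  by move=> cX cY XY; rewrite (inv_critical_uniq inv X'S Y'S cX cY XY).
- move=> X Y /remove_clientsP[X' X'S [-> _]] /remove_clientsP[Y' Y'S [-> _]].
  exact: (inv_critical_level inv X'S Y'S).
- move=> X j /remove_clientsP[X' X'S [-> _]].
  by rewrite /strip /= in_fsetD => /andP[_]; exact: (inv_kappa inv X'S).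
- by move=> X /remove_clientsP[X' X'S [-> _]]; exact: (inv_max inv X'S).
Qed.

Lemma remove_clients_notin S A X j : X \in remove_clients S A ->
  j \in cli X.1 -> j \notin A.
Proof.
by move=> /remove_clientsP[Y _ [-> _]]; rewrite /strip in_fsetD => /andP[].
Qed.

(** The insertions, Fix-Blocking and the main branch of Fix-Level all end by adding one cluster to a
    separated clustering. Only the facility of [C] may lack a critical cluster beforehand: it must
    lack one if [C] is critical, and must have one at level at most [k] if [C] is a satellite. *)
Lemma invariant_addU1 S (C : @flcluster F J) (k : int) : separated S ->
  (forall X, X \in S -> fac X.1 <> fac C ->
     exists Y, [/\ Y \in S, critical Y.1 & fac Y.1 = fac X.1]) ->
  wf_cluster C ->
  (forall X j, X \in S -> j \in cli X.1 -> j \notin cli C) ->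
  (if critical C then forall X, X \in S -> fac X.1 = fac C ->
                        ~~ critical X.1 /\ k <= level X
   else exists2 X, X \in S & [/\ critical X.1, fac X.1 = fac C & level X <= k]) ->
  (forall j, j \in cli C -> kappa (fac C) j <= k) -> k <= lmax ->
  invariant ((C, k) |` S).
Proof.
move=> inv crit_ex wfC disj crit kapC kmax; split; last first.
  have CS : exists Y, [/\ Y \in (C, k) |` S, critical Y.1 & fac Y.1 = fac C].
    case: ifP crit => [Ccrit _|_ [Y YS [Ycrit YC _]]].
      by exists (C, k); split; rewrite ?fset1U1.
    by exists Y; split; rewrite // fset1Ur.
  move=> X /fset1UP[->//|XS] /=.
  have [->//|/eqP XC] := eqVneq (fac X.1) (fac C).
  have [Y [YS Ycrit YX]] := crit_ex _ XS XC.
  by exists Y; split; rewrite // fset1Ur.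
split.
- by move=> X /fset1UP[->|/(inv_wf inv)].
- move=> X Y j /fset1UP[->|XS] /fset1UP[->|YS] //= jX jY.
  + by have := disj _ _ YS jY; rewrite jX.
  + by have := disj _ _ XS jX; rewrite jY.
  + exact: (inv_disjoint inv XS YS jX jY).
- move=> X Y /fset1UP[->|XS] /fset1UP[->|YS] //= cX cY XY.
  + by move: crit; rewrite cX => /(_ _ YS (esym XY))[]; rewrite cY.
  + by move: crit; rewrite cY => /(_ _ XS XY)[]; rewrite cX.
  + exact: (inv_critical_uniq inv).
- move=> X Y /fset1UP[->|XS] /fset1UP[->|YS] //= cX XY.
  + by move: crit; rewrite cX => /(_ _ YS (esym XY))[].
  + move: crit; case: ifP => [_ /(_ _ XS XY)[]|_ [Z ZS [Zcrit ZC Zk]]].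
      by rewrite cX.
    by rewrite (inv_critical_uniq inv XS ZS) // XY ZC.
  + exact: (inv_critical_level inv).
- by move=> X j /fset1UP[->|XS]; [exact: kapC | exact: (inv_kappa inv)].
- by move=> X /fset1UP[->|/(inv_max inv)].
Qed.

Lemma invariant_insert_first S i j : (forall i', ~~ is_open S i') ->
  invariant ((crit_cluster i [fset j], scale (d i j + f i)) |` S).
Proof.
move=> closed; have S0 X : X \in S -> False.
  by move=> XS; have /negP := closed (fac X.1); apply; apply/is_openP; exists X.
have df_gt0 : 0 < d i j + f i by rewrite ltr_wpDr // d_gt0.
have /andP[df1 df2] := scaleP df_gt0.
apply: invariant_addU1 => //.
- by split=> [X /S0|X Y j' /S0|X Y /S0|X Y /S0|X j' /S0|X /S0].
- by move=> X /S0.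
- by move=> X ? /S0.
- by move=> X /S0.
- move=> j'; rewrite inE => /eqP->; rewrite /fac /=.
  have /andP[d1 d2] := scaleP (d_gt0 i j).
  have : (2 : R) ^ (kappa i j - 4) < 2 ^ (scale (d i j + f i) - 3).
    by apply: le_lt_trans d1 _; apply: le_lt_trans df2; rewrite lerDl.
  by rewrite expr2z_lt; lia.
- have := le_lt_trans df1 (df_lt i j); rewrite expr2z_lt; lia.
Qed.

Lemma invariant_insert_critical S i j X : invariant S -> j \notin clients S ->
  X \in clusters_at S i -> critical X.1 -> kappa i j <= level X ->
  invariant ((crit_cluster i (j |` cli X.1), level X) |` (S `\ X)).
Proof.
move=> inv jS; rewrite in_clusters_at => /andP[XS /eqP Xi] Xcrit jX.
have sub : S `\ X `<=` S by exact: fsubD1set.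
apply: invariant_addU1 => //.
- exact: separated_sub sub inv.
- move=> Y /fsetD1P[YX YS] Yi; have [Z [ZS Zcrit ZY]] := inv_critical_ex inv YS.
  exists Z; split=> //; rewrite in_fsetD1 ZS andbT.
  by apply/eqP => ZX; apply: Yi; rewrite -ZY ZX Xi.
- move=> Y j' /fsetD1P[/eqP YX YS] j'Y; rewrite !inE negb_or; apply/andP; split.
    by apply: contraNneq jS => <-; apply/clientsP; exists Y.
  by apply/negP => j'X; apply: YX; exact: (inv_disjoint inv YS XS j'Y j'X).
- move=> Y /fsetD1P[/eqP YX YS] Yi; split.
    apply/negP => Ycrit; apply: YX.
    by apply: (inv_critical_uniq inv) => //; rewrite Yi Xi.
  by apply: (inv_critical_level inv) => //; rewrite Yi Xi.
- by move=> j'; rewrite !inE => /orP[/eqP->//|/(inv_kappa inv XS)]; rewrite Xi.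
- exact: (inv_max inv XS).
Qed.

Lemma invariant_insert_satellite S i j X : invariant S -> j \notin clients S ->
  X \in clusters_at S i -> critical X.1 -> level X < kappa i j ->
  invariant ((sat_cluster i j, kappa i j) |` S).
Proof.
move=> inv jS; rewrite in_clusters_at => /andP[XS /eqP Xi] Xcrit jX.
apply: invariant_addU1 => //.
- exact: inv.
- by move=> Y YS _; exact: (inv_critical_ex inv YS).
- by rewrite /wf_cluster /= cardfs1.
- move=> Y j' YS j'Y; rewrite !inE.
  by apply: contraNneq jS => <-; apply/clientsP; exists Y.
- by exists X => //; split=> //; exact: ltW.
- by move=> j'; rewrite inE => /eqP->.
- exact: kappa_max.
Qed.

(** The treatment of the old critical cluster in Fix-Blocking, isolated so that it can be analysed
    before the new cluster is added. *)
Definition demote S i : @clustering F J :=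
  let old := [fset X in clusters_at S i | critical X.1] in
  let demoted : @clustering F J :=
    [fset ((sat_cluster i j, level X) : @lcluster F J) | X in old, j in cli X.1] in
  (S `\` old) `|` demoted.

Lemma fix_blockingE S C (k : int) : fix_blocking S C k =
  (C, k) |` if critical C then demote (remove_clients S (cli C)) (fac C)
            else remove_clients S (cli C).
Proof. by rewrite /fix_blocking; case: ifP. Qed.

Lemma demoteP S i X : X \in demote S i ->
  (X \in S /\ (critical X.1 -> fac X.1 <> i)) \/
  exists2 Y, [/\ Y \in S, critical Y.1 & fac Y.1 = i]
    & exists2 j, j \in cli Y.1 & X = (sat_cluster i j, level Y).
Proof.
rewrite /demote in_fsetU => /orP[|].
  rewrite !inE => /andP[h XS]; left; split=> // cX Xi; move: h.
  by rewrite XS Xi cX eqxx.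
case/imfset2P => Y; rewrite /= !inE => /andP[/andP[YS /eqP Yi] Ycrit] [j jY ->].
by right; exists Y => //; exists j.
Qed.

Lemma demote_parent S i X : X \in demote S i ->
  exists2 Y, Y \in S & [/\ fac Y.1 = fac X.1, level Y = level X
                         & {subset cli X.1 <= cli Y.1}].
Proof.
case/demoteP => [[XS _]|[Y [YS _ Yi] [j jY ->]]]; first by exists X => //; split.
by exists Y => //; split=> // j'; rewrite inE => /eqP->.
Qed.

Lemma demote_critical S i X : X \in demote S i -> critical X.1 ->
  X \in S /\ fac X.1 <> i.
Proof.
by case/demoteP => [[XS h] /h|[Y _ [j _ ->]]].
Qed.

Lemma demote_keep S i X : X \in S -> fac X.1 <> i -> X \in demote S i.
Proof.
by move=> XS /eqP/negbTE Xi; rewrite /demote !inE XS Xi !andbF /=.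
Qed.

(** For disjointness, a client of a new satellite belonged to the old critical cluster of [i]. A
    kept cluster cannot contain it, and two new satellites sharing it stem from the same cluster and
    coincide. *)
Lemma separated_demote S i : separated S -> separated (demote S i).
Proof.
move=> sep; split.
- move=> X /demoteP[[/(inv_wf sep)]|[Y _ [j _ ->]]] //.
  by rewrite /wf_cluster /= cardfs1.
- move=> X Y j /demoteP[[XS Xi]|[X' [X'S cX' X'i] [j1 j1X' ->]]].
    case/demoteP=> [[YS Yi]|[Y' [Y'S cY' Y'i] [j2 j2Y' ->]]].
      exact: (inv_disjoint sep XS YS).
    move=> jX; rewrite inE => /eqP jj2; rewrite -jj2 in j2Y'.
    have XY := inv_disjoint sep XS Y'S jX j2Y'.
    by case: Xi; rewrite XY.
  case/demoteP=> [[YS Yi]|[Y' [Y'S cY' Y'i] [j2 j2Y' ->]]].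
    rewrite inE => /eqP jj1 jY; rewrite -jj1 in j1X'.
    have XY := inv_disjoint sep YS X'S jY j1X'.
    by case: Yi; rewrite XY.
  rewrite !inE => /eqP jj1 /eqP jj2; rewrite -jj1 in j1X' *.
  rewrite -jj2 in j2Y' *.
  by rewrite (inv_disjoint sep X'S Y'S j1X' j2Y').
- move=> X Y XS YS cX cY XY.
  have [XS' _] := demote_critical XS cX; have [YS' _] := demote_critical YS cY.
  exact: (inv_critical_uniq sep).
- move=> X Y XS YS cX XY; have [XS' _] := demote_critical XS cX.
  have [Y' Y'S [Yi <- _]] := demote_parent YS.
  by apply: (inv_critical_level sep) => //; rewrite Yi.
- move=> X j /demote_parent[Y YS [<- <- sub]] /sub; exact: (inv_kappa sep).
- by move=> X /demote_parent[Y YS [_ <- _]]; exact: (inv_max sep).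
Qed.

Lemma remove_parent S A X : X \in remove_clients S A ->
  exists2 Y, Y \in S & [/\ fac Y.1 = fac X.1, level Y = level X
                         & {subset cli X.1 <= cli Y.1}].
Proof.
move=> /remove_clientsP[Y YS [-> _]]; exists Y => //; split=> // j.
by rewrite /strip in_fsetD => /andP[].
Qed.

Lemma blocking_nonempty S C (k : int) : blocking d f S C k -> cli C != fset0.
Proof. by move=> [_ /cost_avg_lt[]]. Qed.

Lemma invariant_fix_blocking S C (k : int) : invariant S ->
  blocking d f S C k -> invariant (fix_blocking S C k).
Proof.
move=> inv bl; have /fset0Pn[j0 j0C] := blocking_nonempty bl.
case: bl => -[wfC /fsubsetP CS] _ lev cond.
set S1 := remove_clients S (cli C).
have inv1 : invariant S1 by exact: invariant_remove.
(* A blocking cluster has a client, and the present level of that client exceeds [k]. *)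
have kmax : k <= lmax.
  have /clientsP[X XS j0X] := CS _ j0C; have [/(_ X XS j0X)/ltW + _] := lev _ j0C.
  by move/le_trans; apply; exact: (inv_max inv).
rewrite fix_blockingE -/S1; apply: invariant_addU1 => //.
- by case: ifP => _; [apply: separated_demote|]; exact: inv1.
- case: ifP => _ X XS XC.
    have [Y YS [YX _ _]] := demote_parent XS.
    have [Z [ZS Zcrit ZY]] := inv_critical_ex inv1 YS.
    exists Z; split=> //; last by rewrite ZY.
    by apply: demote_keep => //; rewrite ZY YX.
  exact: (inv_critical_ex inv1 XS).
- move=> X j XS jX; have [Y YS jY] : exists2 Y, Y \in S1 & j \in cli Y.1.
    move: XS; case: ifP => [_ /demote_parent[Y YS [_ _ sub]]|_ XS].
      by exists Y; rewrite ?sub.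
    by exists X.
  exact: remove_clients_notin YS jY.
- move: cond; case: ifP => [cC cond X XS XC|cC [X XS [Xcrit Xk]]].
    split; first by apply/negP => /(demote_critical XS)[_].
    have [Y YS [YX <- _]] := demote_parent XS.
    have [Z ZS [ZY <- _]] := remove_parent YS.
    by apply: cond; rewrite in_clusters_at ZS ZY YX XC eqxx.
  move: XS; rewrite in_clusters_at => /andP[XS /eqP XC].
  by exists (strip (cli C) X) => //; exact: remove_clients_critical.
- by move=> j /lev[].
Qed.

Definition absorbed S X : @clustering F J :=
  [fset Y in clusters_at S (fac X.1) | ~~ critical Y.1 & level Y == level X].

(** The result is critical by construction, as only critical clusters violate (I1). *)
Definition absorb S X : @flcluster F J :=
  crit_cluster (fac X.1) (cli X.1 `|` clients (absorbed S X)).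

Lemma fix_levelE S X : critical X.1 -> fix_level d f S X =
  if (clusters_at S (fac X.1) == [fset X]) && (cli X.1 == fset0) then S `\ X
  else (absorb S X, if ((2 ^ level X)%:E <= cost_avg d f (absorb S X))%E
                    then level X + 1 else level X)
       |` ((S `\ X) `\` absorbed S X).
Proof. by move=> Xcrit; rewrite /fix_level Xcrit. Qed.

Lemma in_absorbed S X Y : (Y \in absorbed S X) =
  [&& Y \in S, fac Y.1 == fac X.1, ~~ critical Y.1 & level Y == level X].
Proof. by rewrite !inE -andbA. Qed.

Lemma absorb_parent S X j : X \in S -> j \in cli (absorb S X) ->
  exists2 Y, Y \in S & [/\ fac Y.1 = fac X.1, level Y = level X,
    j \in cli Y.1 & Y = X \/ Y \in absorbed S X].
Proof.
move=> XS; rewrite in_fsetU => /orP[jX|/clientsP[Y YB jY]].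
  by exists X => //; split=> //; left.
move: (YB); rewrite in_absorbed => /and4P[YS /eqP YX _ /eqP Yk].
by exists Y => //; split=> //; right.
Qed.

(** Absorption takes all satellites of the facility at the level of [X]. The remaining ones lie at
    least one level higher, so the critical cluster is still lowest after a raise. *)
Lemma invariant_fix_level S X : invariant S -> X \in S -> ~~ level_ok d f X ->
  invariant (fix_level d f S X).
Proof.
move=> inv XS Xbad.
have Xcrit : critical X.1.
  by apply: contraNT Xbad; exact: (satellite_level_ok inv).
rewrite fix_levelE //; case: ifP => [/andP[/eqP only _]|notonly].
  have sub : S `\ X `<=` S by exact: fsubD1set.
  split; first exact: separated_sub sub inv.
  move=> Y /fsetD1P[/eqP YX YS].
  have [Z [ZS Zcrit ZY]] := inv_critical_ex inv YS.
  exists Z; split=> //; rewrite in_fsetD1 ZS andbT.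
  apply/eqP => ZX; apply: YX; apply/fset1P; rewrite -only in_clusters_at YS.
  by rewrite -ZY ZX eqxx.
have inrest Y : Y \in (S `\ X) `\` absorbed S X ->
    [/\ Y \in S, Y <> X & Y \notin absorbed S X].
  by case/fsetDP=> /fsetD1P[/eqP].
have above Y : Y \in S -> Y <> X -> Y \notin absorbed S X ->
    fac Y.1 = fac X.1 -> ~~ critical Y.1 /\ level X + 1 <= level Y.
  move=> YS YX YB Yi; have Ysat : ~~ critical Y.1.
    by apply/negP => Ycrit; apply: YX; exact: (inv_critical_uniq inv).
  split=> //; have := inv_critical_level inv XS YS Xcrit (esym Yi).
  move: YB; rewrite in_absorbed YS Yi eqxx Ysat /=; move/eqP; lia.
apply: invariant_addU1 => //.
- apply: separated_sub (inv_separated inv).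
  exact: fsubset_trans (fsubsetDl _ _) (fsubD1set _ _).
- move=> Y /inrest[YS YX YB] Yi; have [Z [ZS Zcrit ZY]] := inv_critical_ex inv YS.
  exists Z; split=> //; rewrite in_fsetD in_fsetD1 ZS in_absorbed Zcrit !andbF /=.
  by rewrite andbT; apply/eqP => ZX; apply: Yi; rewrite -ZY ZX.
- move=> Y j /inrest[YS YX YB] jY; apply/negP => /(absorb_parent XS).
  case=> Z ZS [_ _ jZ ZXB]; have YZ := inv_disjoint inv YS ZS jY jZ.
  by case: ZXB; rewrite -YZ // => /(negP YB).
- move=> Y /inrest[YS YX YB] Yi; have [Ysat Yk] := above _ YS YX YB Yi.
  by split=> //; case: ifP => _ //; apply: le_trans Yk; rewrite lerDl.
- move=> j /(absorb_parent XS)[Z ZS [ZX Zk jZ _]].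
  have : kappa (fac X.1) j <= level X by rewrite -ZX -Zk (inv_kappa inv).
  by case: ifP => // _ /le_trans; apply; rewrite lerDl.
- case: ifP => [raise|_]; last exact: (inv_max inv).
  (* An empty cluster has infinite average cost, so [level_lt_max] does not bound its raise. Since
     it was not removed, its facility has another cluster; that one is a satellite left unabsorbed,
     and its higher level bounds the raise. *)
  have [C0|C0] := eqVneq (cli (absorb S X)) fset0; last first.
    have := level_lt_max C0 raise; lia.
  have [X0 B0] : cli X.1 = fset0 /\ clients (absorbed S X) = fset0.
    by move/eqP: C0; rewrite fsetU_eq0 => /andP[/eqP ? /eqP ?].
  have [Y YS [YX Yi]] : exists2 Y, Y \in S & Y <> X /\ fac Y.1 = fac X.1.
    apply: contrapT => none; move: notonly; rewrite X0 eqxx andbT => /eqP; apply.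
    apply/fsetP => Y; rewrite in_clusters_at in_fset1; apply/andP/eqP => [[YS /eqP Yi]|->].
      by apply: contrapT => YX; apply: none; exists Y.
    by split.
  have YB : Y \notin absorbed S X.
    apply/negP => YB; move: (YB); rewrite in_absorbed => /and4P[_ _ Ysat _].
    have [j Yj] := wf_satellite (inv_wf inv YS) Ysat.
    suff : j \in clients (absorbed S X) by rewrite B0.
    by apply/clientsP; exists Y => //; rewrite Yj inE.
  have [_ /le_trans] := above _ YS YX YB Yi; apply; exact: (inv_max inv).
Qed.

Lemma invariant_run us r S : run d f us r S -> invariant S.
Proof.
elim=> {us r S} [|us u r S S' _ inv _ _ []|us r S S' _ inv []].
- by split=> //; split.
- by move=> i j _ /invariant_insert_first h _; exact: h.
- by move=> i j X; exact: invariant_insert_critical.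
- by move=> i j X; exact: invariant_insert_satellite.
- by move=> j _; exact: invariant_remove.
- by move=> C k; exact: invariant_fix_blocking.
- by move=> X _; exact: invariant_fix_level.
Qed.

(** * Recourse of a single step *)

(** [A] holds the clients that are allowed to move. Any other client is still assigned to a facility
    that it had before, and disjointness makes that facility unique. *)
Lemma recourse_le S S' A (n : nat) : invariant S ->
  (#|[set i | is_open S i != is_open S' i]| <= n)%N ->
  (forall i j, j \in clients S -> j \notin A -> assigned S' j i ->
     assigned S j i) ->
  (recourse S S' <= n + #|` A|)%N.
Proof.
move=> inv open_n asg; rewrite /recourse leq_add //; apply: fsubset_leq_card.
apply/fsubsetP => j; rewrite !inE => /andP[jS /existsP[i /existsP[i']]].
case/and3P=> /eqP ii' /assignedP[X [XS Xi jX]] jS'; apply: contrapT => /negP jA.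
have /assignedP[Y [YS Yi jY]] := asg _ _ jS jA jS'.
by apply: ii'; rewrite -Xi -Yi (inv_disjoint inv XS YS jX jY).
Qed.

Lemma open_change0 S S' : (forall i, is_open S i = is_open S' i) ->
  (#|[set i | is_open S i != is_open S' i]| <= 0)%N.
Proof.
by move=> same; rewrite leqn0 cards_eq0; apply/eqP/setP => i; rewrite !inE same eqxx.
Qed.

Lemma open_change1 S S' i0 :
  (forall i, i != i0 -> is_open S i = is_open S' i) ->
  (#|[set i | is_open S i != is_open S' i]| <= 1)%N.
Proof.
move=> same; rewrite -(cards1 i0); apply/subset_leq_card/fintype.subsetP => i.
by rewrite !inE; apply: contraR => /same->; rewrite eqxx.
Qed.

Lemma is_openU1 S C (k : int) i : is_open ((C, k) |` S) i =
  (i == fac C) || is_open S i.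
Proof.
apply/is_openP/orP => [[X /fset1UP[->|XS] Xi]|[/eqP->|/is_openP[X XS Xi]]].
- by left; rewrite -Xi.
- by right; apply/is_openP; exists X.
- by exists (C, k); rewrite ?fset1U1.
- by exists X; rewrite // fset1Ur.
Qed.

Lemma is_openD1 S X i : i != fac X.1 -> is_open (S `\ X) i = is_open S i.
Proof.
move=> iX; apply/is_openP/is_openP => -[Y YS Yi]; exists Y => //.
  by case/fsetD1P: YS.
by apply/fsetD1P; split=> //; apply: contraNneq iX => <-; rewrite Yi.
Qed.

Lemma is_open_remove S A i : invariant S ->
  is_open (remove_clients S A) i = is_open S i.
Proof.
move=> inv; apply/is_openP/is_openP => [[X /remove_parent[Y YS [YX _ _]] Xi]|].
  by exists Y; rewrite ?YX.
move=> [X XS Xi]; have [Y [YS Ycrit YX]] := inv_critical_ex inv XS.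
by exists (strip A Y); [exact: remove_clients_critical | rewrite -Xi -YX].
Qed.

Lemma is_open_demote S i i' : i' != i -> is_open (demote S i) i' = is_open S i'.
Proof.
move=> ii'; apply/is_openP/is_openP => [[X /demote_parent[Y YS [YX _ _]] Xi]|].
  by exists Y; rewrite ?YX.
move=> [X XS Xi]; exists X => //; apply: demote_keep => //.
by rewrite Xi; apply/eqP.
Qed.

(** An emptied critical cluster keeps its facility open, so the closing is counted only when
    Fix-Level removes it. *)
Lemma recourse_remove S A : invariant S -> recourse S (remove_clients S A) = 0%N.
Proof.
move=> inv; apply/eqP; rewrite -leqn0.
apply: leq_trans (@recourse_le _ _ fset0 0 inv _ _) _.
- by apply: open_change0 => i; rewrite is_open_remove.
- move=> i j _ _ /assignedP[X [/remove_parent[Y YS [YX _ sub]] Xi jX]].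
  by apply/assignedP; exists Y; split=> //; [rewrite YX | exact: sub].
- by rewrite cardfs0.
Qed.

Lemma recourse_fix_blocking S C (k : int) : invariant S ->
  (recourse S (fix_blocking S C k) <= 1 + #|` cli C|)%N.
Proof.
move=> inv; apply: recourse_le => //.
  apply: (@open_change1 _ _ (fac C)) => i iC; rewrite fix_blockingE is_openU1.
  rewrite (negbTE iC) /=; case: ifP => _; first rewrite is_open_demote //.
    by rewrite is_open_remove.
  by rewrite is_open_remove.
move=> i j jS jC /assignedP[X [+ Xi jX]]; rewrite fix_blockingE.
case/fset1UP => [XC|XS]; first by rewrite XC /= in jX; rewrite jX in jC.
have [Y YS [YX sub]] : exists2 Y, Y \in remove_clients S (cli C) &
    fac Y.1 = fac X.1 /\ {subset cli X.1 <= cli Y.1}.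
  move: XS; case: ifP => _ XS; last by exists X => //; split.
  by have [Y YS [YX _ sub]] := demote_parent XS; exists Y.
have [Z ZS [ZY _ sub']] := remove_parent YS.
by apply/assignedP; exists Z; split; rewrite // ?ZY ?YX // sub' // sub.
Qed.

Lemma recourse_fix_level S X : invariant S -> X \in S -> critical X.1 ->
  (recourse S (fix_level d f S X) <=
     (clusters_at S (fac X.1) == [fset X]) && (cli X.1 == fset0))%N.
Proof.
move=> inv XS Xcrit; rewrite -[leqRHS]addn0 -(@cardfs0 J).
rewrite fix_levelE //; case: ifP => only; apply: recourse_le => //.
- by apply: (@open_change1 _ _ (fac X.1)) => i iX; rewrite is_openD1.
- move=> i j _ _ /assignedP[Y [/fsetD1P[_ YS] Yi jY]].
  by apply/assignedP; exists Y.
- apply: open_change0 => i; rewrite is_openU1.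
  have [->|iX] := eqVneq i (fac X.1); first by apply/is_openP; exists X.
  apply/is_openP/is_openP => -[Y YS Yi]; exists Y => //.
    rewrite in_fsetD in_fsetD1 YS in_absorbed Yi (negbTE iX) andbF /= andbT.
    by apply: contraNneq iX => <-; rewrite Yi.
  by case/fsetDP: YS => /fsetD1P[].
- move=> i j _ _ /assignedP[Y [/fset1UP[->|YS] Yi jY]].
    have [Z ZS [ZX _ jZ _]] := absorb_parent XS jY.
    by apply/assignedP; exists Z; split=> //; rewrite ZX -Yi.
  have /fsetDP[/fsetD1P[_ YS'] _] := YS.
  by apply/assignedP; exists Y.
Qed.

Lemma recourse_insert S S' C (k : int) j0 : invariant S -> j0 \notin clients S ->
  S' `<=` S ->
  (forall i, i != fac C -> is_open S i = is_open S' i) ->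
  (forall j, j \in cli C -> j = j0 \/ assigned S j (fac C)) ->
  (recourse S ((C, k) |` S') <= 1)%N.
Proof.
move=> inv j0S /fsubsetP sub same new; rewrite -[leqRHS]addn0 -(@cardfs0 J).
apply: recourse_le => //.
  apply: (@open_change1 _ _ (fac C)) => i iC.
  by rewrite is_openU1 (negbTE iC) /= same.
move=> i j jS _ /assignedP[Y [/fset1UP[->|/sub YS] <- jY]].
  by case: (new _ jY) => // jj0; rewrite -jj0 jS in j0S.
by apply/assignedP; exists Y.
Qed.

Lemma recourse_update S u S' : invariant S -> update_step d f S u S' ->
  (recourse S S' <= 1)%N.
Proof.
move=> inv [i j jS _ _|i j X jS XS Xcrit _|i j X jS XS Xcrit _|j jS].
- apply: (recourse_insert _ inv jS) => // j'.
  by rewrite inE => /eqP->; left.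
- move: XS; rewrite in_clusters_at => /andP[XS /eqP Xi].
  apply: (recourse_insert _ inv jS); first exact: fsubD1set.
    by move=> i' i'i; rewrite is_openD1 // Xi.
  move=> j'; rewrite !inE => /orP[/eqP->|j'X]; [by left | right].
  by apply/assignedP; exists X.
- apply: (recourse_insert _ inv jS) => // j'.
  by rewrite inE => /eqP->; left.
- by rewrite recourse_remove.
Qed.

(** * The potential *)

(* The [1] pays for closing the facility; the maximum, which grows by at most 1
   when a client leaves, collects what the leaving clients pay for the rise of
   the remaining ones. *)
Definition potential X : R :=
  5 * #|` cli X.1|%:R * (level X - lmin)%:~R +
  (if critical X.1 then
     1 + 2 * Num.max 0 (f (fac X.1) / 2 ^ (level X - 3) - #|` cli X.1|%:R)
   else 0).

Definition total S : R := \sum_(X <- S) potential X.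

Lemma height_ge0 X : (forall j, j \in cli X.1 -> kappa (fac X.1) j <= level X) ->
  cli X.1 != fset0 -> 0 <= (level X - lmin)%:~R :> R.
Proof.
move=> kap /fset0Pn[j jX]; rewrite ler0z subr_ge0.
exact: le_trans (kappa_min _ _) (kap _ jX).
Qed.

Lemma max_ge0 (x : R) : 0 <= Num.max 0 x.
Proof. by rewrite le_max lexx. Qed.

Lemma potential_ge0 X :
  (forall j, j \in cli X.1 -> kappa (fac X.1) j <= level X) -> 0 <= potential X.
Proof.
move=> kap; rewrite /potential addr_ge0 //.
  have [->|X0] := eqVneq (cli X.1) fset0; first by rewrite cardfs0 mulr0 mul0r.
  by apply: mulr_ge0; [rewrite mulr_ge0 | exact: height_ge0].
by case: ifP => // _; rewrite addr_ge0 // mulr_ge0 // max_ge0.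
Qed.

Lemma separated_potential_ge0 S X : separated S -> X \in S -> 0 <= potential X.
Proof. by move=> sep XS; apply: potential_ge0 => j; exact: (inv_kappa sep). Qed.

(** A departing client releases 5 units per level of height and returns at most 2 units, because the
    maximum in [potential] grows by at most 1 per departure. For a satellite these 2 units are
    slack. *)
Lemma potential_strip A X : potential (strip A X) <=
  potential X - #|` cli X.1 `&` A|%:R * (5 * (level X - lmin)%:~R - 2).
Proof.
rewrite /potential /strip /fac /cli /critical /level /=.
rewrite -!/(fac _) -!/(cli _) -!/(critical _) -!/(level _).
have := congr1 (fun n : nat => n%:R : R) (cardfsID A (cli X.1)).
rewrite natrD; set n := #|` cli X.1|%:R; set p := #|` _ `&` _|%:R.
set q := #|` _ `\` _|%:R => pq; have p0 : 0 <= p by rewrite ler0n.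
set h := (level X - lmin)%:~R; have -> : q = n - p by rewrite -pq addrAC subrr add0r.
have -> : 5 * (n - p) * h = 5 * n * h - p * (5 * h) by ring.
case: ifP => _; last by nra.
set N := _ / _.
have : Num.max 0 (N - (n - p)) <= Num.max 0 (N - n) + p.
  rewrite ge_max addr_ge0 ?max_ge0 //= opprB addrCA addrC lerD2r.
  by rewrite le_max lexx orbT.
by move: (Num.max _ _) (Num.max _ _) => u v uv; nra.
Qed.

(** The sum on the right also counts the emptied satellites that [remove_clients] discards, and
    equal strips repeatedly; this is harmless as all potentials are nonnegative. *)
Lemma total_remove S A : separated S ->
  total (remove_clients S A) <= \sum_(X <- S) potential (strip A X).
Proof.
move=> sep; rewrite -(big_map (strip A) predT potential).
apply: ler_sum_cover.
- exact: fset_uniq.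
- by move=> X /remove_clientsP[Y YS [-> _]]; exact: map_f.
- move=> _ /mapP[X XS ->]; apply: potential_ge0 => j.
  by rewrite in_fsetD => /andP[_ jX]; exact: (inv_kappa sep XS).
Qed.

(** The new satellites together carry exactly the client units of the old critical cluster, whose
    remaining potential is given up. The list [g X] contains what [X] turns into. *)
Lemma total_demote S i : separated S -> total (demote S i) <= total S.
Proof.
move=> sep; pose g X : seq (@lcluster F J) :=
  if critical X.1 && (fac X.1 == i)
  then [seq (sat_cluster i j, level X) | j <- cli X.1] else [:: X].
have gE X : X \in S -> \sum_(Y <- g X) potential Y <= potential X.
  move=> XS; rewrite /g; case: ifP => [/andP[Xcrit _]|_]; last by rewrite big_seq1.
  rewrite big_map /potential Xcrit.
  rewrite (eq_bigr (fun=> 5 * (level X - lmin)%:~R)) => [|j _]; last first.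
    by rewrite /= cardfs1 mulr1 addr0.
  by rewrite sumr_const_fset mulrAC lerDl addr_ge0 // mulr_ge0 // max_ge0.
apply: (@le_trans _ _ (\sum_(Y <- flatten [seq g X | X <- S]) potential Y)).
  apply: ler_sum_cover.
  - exact: fset_uniq.
  - move=> X /demoteP[[XS Xi]|[Y [YS Ycrit Yi] [j jY ->]]].
      apply/flatten_mapP; exists X => //; rewrite /g.
      by case: ifP => [/andP[/Xi + /eqP]|_] //; rewrite mem_head.
    apply/flatten_mapP; exists Y => //; rewrite /g Ycrit Yi eqxx /=.
    by apply/mapP; exists j.
  - move=> Y /flatten_mapP[X XS]; rewrite /g; case: ifP => [/andP[_ /eqP Xi]|_].
      case/mapP => j jX ->; apply: potential_ge0 => j'; rewrite inE => /eqP->.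
      by have := inv_kappa sep XS jX; rewrite Xi.
    by rewrite inE => /eqP->; exact: separated_potential_ge0 sep XS.
rewrite big_flatten big_map /total big_seq [leRHS]big_seq.
exact: ler_sum.
Qed.

Lemma card_bigfcup_le (I : eqType) (s : seq I) (g : I -> {fset J}) :
  (#|` \bigcup_(x <- s) g x| <= \sum_(x <- s) #|` g x|)%N.
Proof.
elim: s => [|x s IHs]; first by rewrite !big_nil cardfs0.
rewrite !big_cons (leq_trans _ (leq_add (leqnn _) IHs)) //.
by rewrite -cardfsUI leq_addr.
Qed.

Lemma card_cover_le S A : A `<=` clients S ->
  #|` A|%:R <= \sum_(X <- S) #|` cli X.1 `&` A|%:R :> R.
Proof.
move=> /fsubsetP AS; rewrite -natr_sum ler_nat.
apply: leq_trans (card_bigfcup_le S (fun X => cli X.1 `&` A)).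
apply: fsubset_leq_card; apply/fsubsetP => j jA.
have /clientsP[X XS jX] := AS _ jA.
by apply/bigfcupP; exists X; rewrite ?XS // in_fsetI jX.
Qed.

Lemma total_U1 S C (k : int) : separated ((C, k) |` S) ->
  total ((C, k) |` S) <= potential (C, k) + total S.
Proof.
move=> sep; apply: (@le_trans _ _ (\sum_(X <- (C, k) :: S) potential X));
  last by rewrite big_cons.
apply: ler_sum_cover.
- exact: fset_uniq.
- by move=> X; rewrite in_fset1U inE.
- move=> X; rewrite inE -in_fset1U; exact: separated_potential_ge0.
Qed.

(** Let [n] be the number of clients of [C] and [h] the height of [k] above [lmin]. By (a) the
    opening cost is below [n * 2 ^ (k - 3)], so the maximum vanishes and the new cluster has
    potential at most [5 * n * h + 1]. Its clients were at height at least [h + 1], so their removal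
    releases at least [5 * n * h + 3 * n]. With recourse at most [1 + n], the balance is at most
    [2 - 2 * n], which is not positive. *)
Lemma total_fix_blocking S C (k : int) : invariant S -> blocking d f S C k ->
  (recourse S (fix_blocking S C k))%:R + total (fix_blocking S C k) <= total S.
Proof.
move=> inv bl; have inv' := invariant_fix_blocking inv bl.
have C0 := blocking_nonempty bl; case: (bl) => -[wfC CS] avg lev _.
have := recourse_fix_blocking C k inv.
rewrite -(ler_nat R) natrD; set r := (recourse _ _)%:R => r_le.
have sep1 := inv_separated (invariant_remove (cli C) inv).
set n := #|` cli C|%:R in r_le.
have n1 : 1 <= n by rewrite ler1n cardfs_gt0.
pose h : R := (k - lmin)%:~R.
have h0 : 0 <= h.
  have /fset0Pn[j jC] := C0; rewrite ler0z subr_ge0.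
  by apply: le_trans (kappa_min (fac C) j) _; have [] := lev _ jC.
have potC : potential (C, k) <= 5 * n * h + 1.
  rewrite /potential lerD2l; case: ifP => // Ccrit.
  rewrite -[leRHS]addr0 lerD2l [Num.max _ _]max_l ?mulr0 //.
  rewrite subr_le0 ler_pdivrMr ?expr2z_gt0 // mulrC.
  have [_ /ltW] := cost_avg_lt avg; apply: le_trans.
  by rewrite /cost Ccrit lerDl sumr_ge0 // => j _; rewrite ltW // d_gt0.
have tot1 : total (remove_clients S (cli C)) <= total S - n * (5 * (h + 1) - 2).
  apply: le_trans (total_remove _ inv) _.
  apply: (@le_trans _ _ (\sum_(X <- S) (potential X -
      #|` cli X.1 `&` cli C|%:R * (5 * (h + 1) - 2)))).
    rewrite big_seq [leRHS]big_seq; apply: ler_sum => X XS.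
    apply: le_trans (potential_strip _ _) _; rewrite lerD2l lerN2.
    (* Only clusters that meet [C] are known to lie above level [k]; the others lose nothing. *)
    have [->|/fset0Pn[j]] := eqVneq (cli X.1 `&` cli C) fset0.
      by rewrite cardfs0 !mul0r.
    rewrite in_fsetI => /andP[jX jC]; rewrite ler_wpM2l // lerD2r ler_pM2l //.
    have [/(_ X XS jX) kX _] := lev _ jC.
    by rewrite /h -[1]/(1%:~R) -intrD ler_int; lia.
  rewrite sumrB -mulr_suml lerD2l lerN2 ler_wpM2r ?card_cover_le //.
  by lra.
have tot2 : total (fix_blocking S C k) <=
    potential (C, k) + total (remove_clients S (cli C)).
  move: inv'; rewrite fix_blockingE => /inv_separated/total_U1/le_trans; apply.
  by rewrite lerD2l; case: ifP => // _; exact: total_demote.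
have : 0 <= n * h by rewrite mulr_ge0 // (le_trans _ n1).
nra.
Qed.

(** All merged clusters have the same level, so their client units add up, while a larger number of
    clients can only lower the maximum. *)
Lemma potential_absorb S X : invariant S -> X \in S -> critical X.1 ->
  potential (absorb S X, level X) <=
  potential X + \sum_(Y <- absorbed S X) potential Y.
Proof.
move=> inv XS Xcrit.
have subX : cli X.1 `<=` cli (absorb S X) by exact: fsubsetUl.
have sumB_ge0 : 0 <= \sum_(Y <- absorbed S X) potential Y.
  rewrite big_seq; apply: sumr_ge0 => Y; rewrite in_absorbed => /andP[YS _].
  exact: separated_potential_ge0 inv YS.
(* The invariant bounds levels from below only through clients, so the sign of the height is unknown
   in the empty case. *)
have [C0|C0] := eqVneq (cli (absorb S X)) fset0.
  have X0 : cli X.1 = fset0 by apply/eqP; rewrite -fsubset0 -C0.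
  rewrite -[leLHS]addr0 lerD // /potential [cli (_, _).1]C0 X0 Xcrit.
  by rewrite cardfs0 !mulr0 !mul0r.
have h0 : 0 <= (level X - lmin)%:~R :> R.
  apply: (@height_ge0 (absorb S X, level X)) => // j.
  move=> /(absorb_parent XS)[Y YS [YX <- jY _]]; rewrite /= -[fac _]YX.
  exact: (inv_kappa inv).
have sumB : \sum_(Y <- absorbed S X) potential Y =
    5 * (\sum_(Y <- absorbed S X) #|` cli Y.1|)%N%:R * (level X - lmin)%:~R.
  rewrite natr_sum mulr_sumr mulr_suml big_seq [RHS]big_seq.
  apply: eq_bigr => Y; rewrite in_absorbed => /and4P[_ _ Ysat /eqP Yk].
  by rewrite /potential (negbTE Ysat) addr0 Yk.
rewrite sumB {1 2}/potential Xcrit /= addrAC lerD //.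
  rewrite -mulrDl -mulrDr -natrD ler_wpM2r // ler_pM2l // ler_nat.
  apply: leq_trans (leq_add (leqnn _) (card_bigfcup_le _ _)).
  by rewrite -cardfsUI leq_addr.
rewrite lerD2l ler_pM2l // ge_max max_ge0 /= le_max; apply/orP; right.
by rewrite lerD2l lerN2 ler_nat fsubset_leq_card.
Qed.

(** The distances are below [2 ^ (k - 3)] and the average cost is at least 8 times that, so
    [7 * n <= N]; if [C] is empty, this is just [0 <= N]. Both maxima are then attained by their
    second argument, and halving [N] frees [N] units, more than enough for the [5 * n] that the
    raise costs. *)
Lemma potential_raise C (k : int) : critical C ->
  (forall j, j \in cli C -> kappa (fac C) j <= k) ->
  ((2 ^ k)%:E <= cost_avg d f C)%E -> potential (C, k + 1) <= potential (C, k).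
Proof.
move=> Ccrit kap avg; rewrite /potential Ccrit /level /=.
set n := #|` cli C|%:R; set N := f (fac C) / 2 ^ (k - 3).
have n0 : 0 <= n by rewrite ler0n.
have p0 : 0 < (2 : R) ^ (k - 3) by exact: expr2z_gt0.
have -> : f (fac C) / 2 ^ (k + 1 - 3) = N / 2.
  have -> : k + 1 - 3 = k - 3 + 1 by lia.
  by rewrite expr2zD expr1z invfM mulrA.
have nN : 7 * n <= N.
  have [C0|C0] := eqVneq (cli C) fset0.
    by rewrite /n C0 cardfs0 mulr0 divr_ge0 // ltW.
  rewrite ler_pdivlMr //; have := cost_avg_ge C0 avg; rewrite /cost Ccrit -/n.
  have : \sum_(j <- cli C) d (fac C) j <= 2 ^ (k - 3) * n.
    by apply: sum_dist_le => j /kap/d_lt_level/ltW.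
  have -> : (2 : R) ^ k = 8 * 2 ^ (k - 3).
    have {1}-> : k = 3 + (k - 3) by lia.
    by rewrite expr2zD; congr (_ * _); rewrite -exprnP; ring.
  by move: (\sum_(j <- _) _) => s; lra.
have -> : (k + 1 - lmin)%:~R = (k - lmin)%:~R + 1 :> R.
  by rewrite -[1 in RHS]/(1%:~R) -intrD; congr (_%:~R); lia.
move: (k - lmin)%:~R => h.
rewrite !max_r; [nra | lra | lra].
Qed.

Lemma total_fix_level S X : invariant S -> X \in S -> ~~ level_ok d f X ->
  (recourse S (fix_level d f S X))%:R + total (fix_level d f S X) <= total S.
Proof.
move=> inv XS Xbad.
have Xcrit : critical X.1.
  by apply: contraNT Xbad; exact: (satellite_level_ok inv).
have := recourse_fix_level inv XS Xcrit.
have := invariant_fix_level inv XS Xbad.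
rewrite fix_levelE //; case: ifP => [/andP[_ /eqP X0] _|_ inv'].
  (* When the facility closes, the constant 1 in the potential of [X] pays for it. *)
  rewrite -(ler_nat R) => r_le; rewrite [leRHS](big_fsetD1 X) //= lerD //.
  apply: le_trans r_le _; rewrite /potential X0 Xcrit cardfs0 mulr0 mul0r add0r.
  by rewrite lerDl mulr_ge0 // max_ge0.
rewrite leqn0 => /eqP->; rewrite add0r.
apply: le_trans (total_U1 (inv_separated inv')) _.
rewrite [leRHS](big_fsetD1 X) //=.
set rest := total _.
have restE : \sum_(Y <- absorbed S X) potential Y + rest <=
    \sum_(Y <- S `\ X) potential Y.
  rewrite /rest /total -big_cat; apply: ler_sum_cover.
  - rewrite cat_uniq !fset_uniq /= andbT; apply/hasPn => Y.
    by case/fsetDP.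
  - move=> Y; rewrite mem_cat => /orP[|/fsetDP[//]].
    rewrite in_absorbed in_fsetD1 => /and4P[-> _ Ysat _]; rewrite andbT.
    by apply: contraNneq Ysat => ->.
  - by move=> Y /fsetD1P[_ YS]; exact: separated_potential_ge0 inv YS.
apply: le_trans (lerD (lexx _) restE); rewrite addrA lerD2r.
apply: le_trans (potential_absorb inv XS Xcrit).
case: ifP => // raise; apply: potential_raise => // j.
move=> /(absorb_parent XS)[Y YS [YX <- jY _]]; rewrite -[fac _]YX.
exact: (inv_kappa inv).
Qed.

(** An insertion brings the units of one client, and 1 more if it opens a facility. A deletion can
    only increase one maximum, by at most 1, which accounts for 2 units. *)
Lemma total_update S u S' : invariant S -> update_step d f S u S' ->
  total S' <= total S + 5 * (lmax - lmin)%:~R + 3.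
Proof.
move=> inv upd; have inv' : invariant S'.
  case: upd => [i j _ S0 _|i j X|i j X|j _].
  - exact: invariant_insert_first.
  - exact: invariant_insert_critical.
  - exact: invariant_insert_satellite.
  - exact: invariant_remove.
have heightM X : X \in S' -> (level X - lmin)%:~R <= (lmax - lmin)%:~R :> R.
  by move=> /(inv_max inv') Xmax; rewrite ler_int lerD2r.
case: upd inv' heightM => [i j jS _ _|i j X jS XS Xcrit jX|i j X jS XS Xcrit jX|j jS].
- move=> inv' /(_ _ (fset1U1 _ _)); rewrite /level /= => h.
  apply: le_trans (total_U1 (inv_separated inv')) _.
  rewrite addrC -[leRHS]addrA lerD2l /potential /fac /cli /level /= cardfs1.
  have df_gt0 : 0 < d i j + f i by rewrite ltr_wpDr // d_gt0.
  (* The first cluster starts at the scale of [d i j + f i], so its single client already makes the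
     maximum vanish. *)
  rewrite [Num.max _ _]max_l; first lra.
  rewrite subr_le0 ler_pdivrMr ?expr2z_gt0 // mul1r.
  have /andP[_ /ltW] := scaleP df_gt0; apply: le_trans.
  by rewrite lerDr ltW // d_gt0.
- move=> inv' /(_ _ (fset1U1 _ _)); rewrite /level /= -/(level X) => h.
  move: XS; rewrite in_clusters_at => /andP[XS /eqP Xi].
  apply: le_trans (total_U1 (inv_separated inv')) _.
  have -> : total S = potential X + total (S `\ X) by exact: big_fsetD1.
  suff : potential (crit_cluster i (j |` cli X.1), level X) <=
      potential X + 5 * (lmax - lmin)%:~R + 3 by lra.
  have jX' : j \notin cli X.1.
    by apply: contra jS => jX'; apply/clientsP; exists X.
  rewrite /potential Xcrit /= Xi /fac /cli /level /= -/(level X) -/(cli X.1).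
  rewrite cardfsU1 jX' natrD -[true%:R]/1.
  set n := #|` cli X.1|%:R; set N := f i / _.
  have uv : Num.max 0 (N - (1 + n)) <= Num.max 0 (N - n).
    by rewrite ge_max max_ge0 /= le_max lerD2l lerN2 lerDr ler01 orbT.
  by lra.
- move=> inv' /(_ _ (fset1U1 _ _)); rewrite /level /= => h.
  apply: le_trans (total_U1 (inv_separated inv')) _.
  rewrite addrC -[leRHS]addrA lerD2l /potential /fac /cli /level /= cardfs1.
  by lra.
- move=> inv' _; have /clientsP[X XS jX] := jS.
  apply: le_trans (total_remove _ inv) _.
  have h0 : 0 <= (lmax - lmin)%:~R :> R.
    rewrite ler0z subr_ge0; apply: le_trans (kappa_min (fac X.1) j) _.
    exact: kappa_max.
  apply: (@le_trans _ _ (total S + 2)); last lra.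
  rewrite [leLHS](big_fsetD1 X) //= [total S](big_fsetD1 X) //= [leRHS]addrAC.
  apply: lerD.
    apply: le_trans (potential_strip _ _) _.
    have -> : cli X.1 `&` [fset j] = [fset j].
      by apply/fsetIidPr; rewrite fsub1set.
    rewrite cardfs1 mul1r lerD2l opprB lerBlDr lerDl mulr_ge0 //.
    rewrite ler0z subr_ge0; apply: le_trans (kappa_min (fac X.1) j) _.
    exact: (inv_kappa inv).
  rewrite big_seq [leRHS]big_seq; apply: ler_sum => Y /fsetD1P[/eqP YX YS].
  apply: le_trans (potential_strip _ _) _.
  have -> : cli Y.1 `&` [fset j] = fset0.
    apply/fsetP => j'; rewrite !inE; apply/andP => -[j'Y /eqP j'j].
    by apply: YX; apply: (inv_disjoint inv YS XS _ jX); rewrite -j'j.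
  by rewrite cardfs0 mul0r subr0.
Qed.

(** Each update adds at most [5 * (lmax - lmin) + 3] to the potential and at most 1 to the recourse;
    the iterations of Fix-Clustering are paid from the potential. *)
Lemma run_bound us r S : run d f us r S ->
  r%:R + total S <= (5 * (lmax - lmin)%:~R + 4) * (size us)%:R.
Proof.
elim=> {us r S} [|us u r S S' rS IH _ _ upd|us r S S' rS IH step].
- by rewrite /total big_nil mulr0 addr0.
- have inv := invariant_run rS; have := recourse_update inv upd.
  rewrite -(ler_nat R) => r_le; have := total_update inv upd.
  rewrite size_rcons natrD -natr1; lra.
- rewrite natrD; apply: le_trans IH; rewrite -addrA lerD2l.
  have inv := invariant_run rS.
  case: step => [C k|X _]; [exact: total_fix_blocking | exact: total_fix_level].
Qed.

Lemma run_recourse us r S : run d f us r S ->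
  r%:R <= (5 * (lmax - lmin)%:~R + 4) * (size us)%:R :> R.
Proof.
move=> rS; apply: le_trans (run_bound rS); rewrite lerDl /total big_seq.
apply: sumr_ge0 => X; exact: separated_potential_ge0 (invariant_run rS).
Qed.

End Amortization.

(** * From polynomial bounds to a logarithmic window of levels *)

Lemma horner_le_expr2 (R : realType) (P : {poly R}) :
  exists c : nat, forall m t : nat, (0 < m)%N -> (m <= 2 ^ t)%N ->
    P.[m%:R] <= 2 ^+ (c + size P * t).
Proof.
have [c ltc] := ltr_expr2 (\sum_(i < size P) `|P`_i|); exists c => m t m0 mt.
rewrite horner_coef exprD.
(* Each power of [m] that occurs is at most [m ^ size P], and [2 ^+ c] exceeds the sum of the
   absolute values of the coefficients. *)
apply: (@le_trans _ _ (\sum_(i < size P) `|P`_i| * 2 ^+ (size P * t))).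
  apply: ler_sum => i _; apply: le_trans (ler_norm _) _.
  rewrite normrM ler_wpM2l // normrX normr_nat -!natrX ler_nat.
  rewrite mulnC expnM; apply: (@leq_trans (m ^ size P)).
    by rewrite leq_pexp2l // ltnW.
  by rewrite leq_exp2r // (leq_ltn_trans _ (ltn_ord i)).
by rewrite -mulr_suml ler_wpM2r ?exprn_ge0 // ltW.
Qed.

Theorem theorem4 (R : realType) (P : {poly R}) :
  exists K : R,
    forall (F : finType) (J : choiceType) (V : metricType R)
           (posF : F -> V) (posJ : J -> V) (f : F -> R),
      let d := fun (i : F) (j : J) => mdist (posF i) (posJ j) in
      (1 < #|F|)%N ->
      (forall i j, 0 < d i j) ->
      (forall i, 0 <= f i) ->
      (forall i j, d i j <= P.[#|F|%:R] /\ (d i j)^-1 <= P.[#|F|%:R]) ->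
      (forall i, f i <= P.[#|F|%:R]) ->
      forall (us : seq update) (r : nat) (S : clustering),
        run d f us r S ->
        r%:R <= K * (size us)%:R * ln #|F|%:R.
Proof.
(* The window will have width [2 * n + 1] with [n = c + size P * t.+1], so the cost per update is
   [5 * (2 * n + 1) + 4 = 10 * n + 9]. As [t] is at least 1, [t.+1 <= 2 * t] and this is at most
   [a * t]. *)
have [c Pc] := horner_le_expr2 P; pose a : nat := (10 * (c + 2 * size P) + 9)%N.
exists (a%:R / ln 2) => F J V posF posJ f d F1 d_gt0 f_ge0 dP fP us r S.
set m := #|F| in F1 dP fP *; pose t := trunc_log 2 m.
have /andP[tm mt] : (2 ^ t <= m < 2 ^ t.+1)%N by apply: trunc_log_bounds; lia.
have t1 : (0 < t)%N by rewrite trunc_log_gt0.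
pose n := (c + size P * t.+1)%N.
have {Pc}Pn : P.[m%:R] <= 2 ^+ n by apply: Pc; [exact: ltnW | exact: ltnW].
(* The choice [lmin = 4 - n] comes from the bound [2 ^+ n] on inverse distances. *)
have d_ge i j : 2 ^ (4 - n%:Z - 4) <= d i j.
  have -> : 4 - n%:Z - 4 = - n%:Z by lia.
  rewrite -invr_expz -exprnP invf_ple ?posrE ?exprn_gt0 //.
  by apply: le_trans Pn; have [] := dP i j.
(* The choice [lmax = n + 5] leaves room for the sum of two terms bounded by [2 ^+ n]. *)
have df_lt i j : d i j + f i < 2 ^ (n%:Z + 5 - 3).
  have -> : n%:Z + 5 - 3 = n.+2%:Z by lia.
  rewrite -exprnP !exprS; have : (0 : R) < 2 ^+ n by rewrite exprn_gt0.
  by have [] := dP i j; have := fP i; lra.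
move=> /(run_recourse d_ge f_ge0 df_lt) r_le; apply: le_trans r_le _.
rewrite [leRHS]mulrAC ler_wpM2r //.
apply: (@le_trans _ _ (a * t)%:R).
  have -> : n%:Z + 5 - (4 - n%:Z) = (2 * n + 1)%N%:Z by lia.
  rewrite -pmulrn -natrM -natrD ler_nat /a /n; nia.
rewrite natrM -mulrA ler_wpM2l // [leRHS]mulrC ler_pdivlMr ?ln_gt0 ?ltr1n //.
(* The remaining inequality is [t * ln 2 <= ln m], that is, [2 ^ t <= m]. *)
rewrite mulr_natl -lnXn // -natrX ler_ln ?posrE ?ltr0n ?expn_gt0 //.
  by rewrite ler_nat.
by rewrite (leq_trans _ tm) // expn_gt0.
Qed.
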